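(* Let $(D,\dashv,\vdash)$ be a diassociative algebra. Then the quadruple $(D,\cdot,\{~,~,~\},\{\!\{~,~,~\}\!\})$ is an associative-Yamaguti algebra, where for $a,b,c\in D$, $$a\cdot b:=a\dashv b+a\vdash b,$$ $$\{a,b,c\}:=-(a\dashv b)\vdash c=-(a\vdash b)\vdash c=-a\vdash(b\vdash c),$$ $$\{\!\{a,b,c\}\!\}:=-a\dashv(b\vdash c)=-a\dashv(b\dashv c)=-(a\dashv b)\dashv c.$$ Moreover, if $(D,\dashv,\vdash)$ and $(D',\dashv',\vdash')$ are two diassociative algebras and $\varphi:D\to D'$ is a homomorphism of diassociative algebras, then $\varphi$ is also a homomorphism between the corresponding associative-Yamaguti algebras.
   Context: All vector spaces, linear maps and tensor products are over a field $\mathbf{k}$ of characteristic $0$. An associative-Yamaguti algebra is a quadruple $(A,\cdot,\{~,~,~\},\{\!\{~,~,~\}\!\})$ consisting of a vector space $A$ with linear operations $\cdot:A\otimes A\to A$ and $\{~,~,~\},\{\!\{~,~,~\}\!\}:A\otimes A\otimes A\to A$ such that for all $a,b,c,d,e\in A$: (AY1) $(a\cdot b)\cdot c-a\cdot(b\cdot c)+\{a,b,c\}-\{\!\{a,b,c\}\!\}=0$; (AY2) $\{a\cdot b,c,d\}=\{a,b\cdot c,d\}$; (AY3) $\{a,b,c\cdot d\}=\{a,b,c\}\cdot d$; (AY4) $\{\!\{a\cdot b,c,d\}\!\}=a\cdot\{\!\{b,c,d\}\!\}$; (AY5) $\{\!\{a,b\cdot c,d\}\!\}=\{\!\{a,b,c\cdot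 d\}\!\}$; (AY6) $a\cdot\{b,c,d\}=\{\!\{a,b,c\}\!\}\cdot d$; (AY7) $\{\{a,b,c\},d,e\}=\{a,\{\!\{b,c,d\}\!\},e\}=\{a,b,\{c,d,e\}\}$; (AY8) $\{a,\{b,c,d\},e\}=\{\{\!\{a,b,c\}\!\},d,e\}$; (AY9) $\{\!\{\{\!\{a,b,c\}\!\},d,e\}\!\}=\{\!\{a,\{b,c,d\},e\}\!\}=\{\!\{a,b,\{\!\{c,d,e\}\!\}\}\!\}$; (AY10) $\{\!\{a,\{\!\{b,c,d\}\!\},e\}\!\}=\{\!\{a,b,\{c,d,e\}\}\!\}$; (AY11) $\{a,b,\{\!\{c,d,e\}\!\}\}=\{\!\{\{a,b,c\},d,e\}\!\}$. A homomorphism of associative-Yamaguti algebras is a linear map preserving the three operations. A diassociative algebra is a triple $(D,\dashv,\vdash)$ of a vector space $D$ with linear operations $\dashv,\vdash:D\otimes D\to D$ such that $(D,\dashv)$ and $(D,\vdash)$ are both associative algebras and, for all $a,b,c\in D$, $a\dashv(b\dashv c)=a\dashv(b\vdash c)$, $(a\vdash b)\dashv c=a\vdash(b\dashv c)$, and $(a\vdash b)\vdash c=(a\dashv b)\vdash c$. A homomorphism of diassociative algebras is a linear map $\varphi$ with $\varphi(a\dashv b)=\varphi(a)\dashv'\varphi(b)$ and $\varphi(a\vdash b)=\varphi(a)\vdash'\varphi(b)$ for all $a,b$. Algebras are not assumed unital. *)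

(* Defs.v *)
From HB Require Import structures.
From mathcomp Require Import all_boot all_order all_algebra.

Set Implicit Arguments.
Unset Strict Implicit.
Unset Printing Implicit Defensive.

Import GRing.Theory.
Local Open Scope ring_scope.

(* A linear map out of a tensor product of two or three copies of V is given
   as a curried map that is linear in each argument separately. *)

Definition bilinear_op (k : fieldType) (V : lmodType k) (op : V -> V -> V)
    : Prop :=
  (forall b, linear (fun a => op a b)) /\
  (forall a, linear (fun b => op a b)).

Definition trilinear_op (k : fieldType) (V : lmodType k)
    (op : V -> V -> V -> V) : Prop :=
  [/\ forall b c, linear (fun a => op a b c),
      forall a c, linear (fun b => op a b c)
    & forall a b, linear (fun c => op a b c)].

(* m a b is a . b, t a b c is {a, b, c} and s a b c is {{a, b, c}}. *)
Record assoc_yamaguti (k : fieldType) (A : lmodType k)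
    (m : A -> A -> A) (t s : A -> A -> A -> A) : Prop := AssocYamaguti {
  ay_mul_bilinear : bilinear_op m;
  ay_brk_trilinear : trilinear_op t;
  ay_dbrk_trilinear : trilinear_op s;
  ay1 : forall a b c : A, m (m a b) c - m a (m b c) + t a b c - s a b c = 0;
  ay2 : forall a b c d : A, t (m a b) c d = t a (m b c) d;
  ay3 : forall a b c d : A, t a b (m c d) = m (t a b c) d;
  ay4 : forall a b c d : A, s (m a b) c d = m a (s b c d);
  ay5 : forall a b c d : A, s a (m b c) d = s a b (m c d);
  ay6 : forall a b c d : A, m a (t b c d) = m (s a b c) d;
  ay7 : forall a b c d e : A,
    t (t a b c) d e = t a (s b c d) e /\
    t a (s b c d) e = t a b (t c d e);
  ay8 : forall a b c d e : A, t a (t b c d) e = t (s a b c) d e;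
  ay9 : forall a b c d e : A,
    s (s a b c) d e = s a (t b c d) e /\
    s a (t b c d) e = s a b (s c d e);
  ay10 : forall a b c d e : A, s a (s b c d) e = s a b (t c d e);
  ay11 : forall a b c d e : A, t a b (s c d e) = s (t a b c) d e
}.

Record assoc_yamaguti_hom (k : fieldType) (A A' : lmodType k)
    (m : A -> A -> A) (t s : A -> A -> A -> A)
    (m' : A' -> A' -> A') (t' s' : A' -> A' -> A' -> A')
    (phi : A -> A') : Prop := AssocYamagutiHom {
  ay_hom_linear : linear phi;
  ay_hom_mul : forall a b : A, phi (m a b) = m' (phi a) (phi b);
  ay_hom_brk : forall a b c : A, phi (t a b c) = t' (phi a) (phi b) (phi c);
  ay_hom_dbrk : forall a b c : A, phi (s a b c) = s' (phi a) (phi b) (phi c)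
}.

(* l a b is a -| b and r a b is a |- b. *)
Record diassociative (k : fieldType) (D : lmodType k) (l r : D -> D -> D)
    : Prop := Diassociative {
  dias_left_bilinear : bilinear_op l;
  dias_right_bilinear : bilinear_op r;
  dias_left_assoc : associative l;
  dias_right_assoc : associative r;
  dias_left_right : forall a b c : D, l a (l b c) = l a (r b c);
  dias_inner : forall a b c : D, l (r a b) c = r a (l b c);
  dias_right_left : forall a b c : D, r (r a b) c = r (l a b) c
}.

Record diassociative_hom (k : fieldType) (D D' : lmodType k)
    (l r : D -> D -> D) (l' r' : D' -> D' -> D') (phi : D -> D') : Prop :=
  DiassociativeHom {
  dias_hom_linear : linear phi;
  dias_hom_left : forall a b : D, phi (l a b) = l' (phi a) (phi b);
  dias_hom_right : forall a b : D, phi (r a b) = r' (phi a) (phi b)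
}.

Section DiasOps.
Variables (k : fieldType) (D : lmodType k) (l r : D -> D -> D).

Definition dias_mul (a b : D) : D := l a b + r a b.
Definition dias_brk (a b c : D) : D := - r (l a b) c.
Definition dias_dbrk (a b c : D) : D := - l a (r b c).

End DiasOps.

(* Main.v *)
Require Import Defs.
From HB Require Import structures.
From mathcomp Require Import all_boot all_order all_algebra.

Set Implicit Arguments.
Unset Strict Implicit.
Unset Printing Implicit Defensive.

Import GRing.Theory.
Local Open Scope ring_scope.

(** In a diassociative algebra, a bracketed product of [a1, .., an] depends only on the order of the
    factors and on one distinguished factor, its centre, found by following [l] to the left argument
    and [r] to the right one. Thus [dias_brk] is minus the product of three factors centred at the
    last, [dias_dbrk] is minus the one centred at the first, and [dias_mul] sums both choices. By
    bilinearity every axiom becomes an identity between signed sums of such products, checked by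
    comparing centres. The lemmas [dias_left_nest] to [dias_left_right_nest], with the inner law,
    give the normal form; the [bilin_op] lemmas give the expansion. *)

Section BilinearOp.
Variables (k : fieldType) (D : lmodType k) (op : D -> D -> D).
Hypothesis op_bilin : bilinear_op op.

Lemma bilin_opDl a b c : op (a + b) c = op a c + op b c.
Proof. by case: op_bilin => lin _; have := lin c 1 a b; rewrite !scale1r. Qed.

Lemma bilin_opDr a b c : op a (b + c) = op a b + op a c.
Proof. by case: op_bilin => _ lin; have := lin a 1 b c; rewrite !scale1r. Qed.

Lemma bilin_op0l c : op 0 c = 0.
Proof. by apply: (addrI (op 0 c)); rewrite -bilin_opDl !addr0. Qed.

Lemma bilin_op0r a : op a 0 = 0.
Proof. by apply: (addrI (op a 0)); rewrite -bilin_opDr !addr0. Qed.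

(** [linear] speaks of [x *: a + b] only, so homogeneity is the case [b = 0] and relies on
    [bilin_op0l]. *)
Lemma bilin_opZl x a c : op (x *: a) c = x *: op a c.
Proof.
case: op_bilin => lin _.
by have := lin c x a 0; rewrite bilin_op0l !addr0.
Qed.

Lemma bilin_opZr x a b : op a (x *: b) = x *: op a b.
Proof.
case: op_bilin => _ lin.
by have := lin a x b 0; rewrite bilin_op0r !addr0.
Qed.

Lemma bilin_opNl a c : op (- a) c = - op a c.
Proof. by rewrite -!scaleN1r bilin_opZl. Qed.

Lemma bilin_opNr a b : op a (- b) = - op a b.
Proof. by rewrite -!scaleN1r bilin_opZr. Qed.

Definition bilin_opE := (bilin_opDl, bilin_opDr, bilin_opZl, bilin_opZr,
                         bilin_opNl, bilin_opNr).

End BilinearOp.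

Section DiassociativeNormalForm.
Variables (k : fieldType) (D : lmodType k) (l r : D -> D -> D).
Hypothesis D_dias : diassociative l r.

Let l_bilin := dias_left_bilinear D_dias.
Let r_bilin := dias_right_bilinear D_dias.

Let linE := (bilin_opE l_bilin, bilin_opE r_bilin).

(** This and the next three lemmas orient the axioms towards right nesting, with [l] kept inside the
    right argument of [l], so that they can serve as rewrite rules. *)
Lemma dias_left_nest a b c : l (l a b) c = l a (l b c).
Proof. by rewrite (dias_left_assoc D_dias). Qed.

Lemma dias_right_nest a b c : r (r a b) c = r a (r b c).
Proof. by rewrite (dias_right_assoc D_dias). Qed.

Lemma dias_right_left_nest a b c : r (l a b) c = r a (r b c).
Proof. by rewrite -(dias_right_left D_dias) dias_right_nest. Qed.

Lemma dias_left_right_nest a b c : l a (r b c) = l a (l b c).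
Proof. by rewrite (dias_left_right D_dias). Qed.

(* Rewriting with these rules brings every monomial to its normal form
   a1 |- (.. |- (ai -| (.. -| an))). *)
Let nestE := (dias_left_nest, dias_right_nest, dias_right_left_nest,
              dias_left_right_nest, dias_inner D_dias).

Lemma dias_mul_bilinear : bilinear_op (dias_mul l r).
Proof.
by split=> [b x a c | a x b c]; rewrite /dias_mul !linE scalerDr addrACA.
Qed.

Lemma dias_brk_trilinear : trilinear_op (dias_brk l r).
Proof.
by split=> [b c x a d | a c x b d | a b x c d];
   rewrite /dias_brk !linE opprD scalerN.
Qed.

Lemma dias_dbrk_trilinear : trilinear_op (dias_dbrk l r).
Proof.
by split=> [b c x a d | a c x b d | a b x c d];
   rewrite /dias_dbrk !linE opprD scalerN.
Qed.

(** All three products have centre [c], hence the same normal form [r a (r b c)]. *)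
Lemma dias_brkE a b c :
  dias_brk l r a b c = - r (r a b) c /\ - r (r a b) c = - r a (r b c).
Proof. by rewrite /dias_brk !nestE. Qed.

(** Here the common centre is [a], with normal form [l a (l b c)]. *)
Lemma dias_dbrkE a b c :
  dias_dbrk l r a b c = - l a (l b c) /\ - l a (l b c) = - l (l a b) c.
Proof. by rewrite /dias_dbrk !nestE. Qed.

Lemma dias_assoc_yamaguti :
  assoc_yamaguti (dias_mul l r) (dias_brk l r) (dias_dbrk l r).
Proof.
split; first exact: dias_mul_bilinear.
- exact: dias_brk_trilinear.
- exact: dias_dbrk_trilinear.
(* Let A, B, C be the products of [a, b, c] centred at [a], [b], [c]. The two bracketings under
   [dias_mul] are A + B + 2C and 2A + B + C; their difference C - A is cancelled by the brackets -C
   and -A. *)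
- move=> a b c; rewrite /dias_mul /dias_brk /dias_dbrk !linE !nestE opprK.
  (* Negative terms are gathered on one side, so that both sides become A + A + B + C + C. *)
  rewrite addrAC [X in X - _]addrAC -[LHS]addrA -opprD; apply/eqP.
  by rewrite subr_eq0 addrAC [X in X + _ == _]addrAC !addrA.
(* In each remaining axiom both sides expand to the same centres with the same signs: in [ay6], for
   instance, minus the products centred at [a] and at [d]; in [ay11], the product centred at [c]. *)
all: by move=> *; rewrite /dias_mul /dias_brk /dias_dbrk ?linE ?nestE
                         ?linE ?nestE ?opprD ?opprK.
Qed.

End DiassociativeNormalForm.

(** The three operations are built from the two products by composition, sum and sign, all of which
    [phi] respects. *)
Lemma dias_hom_assoc_yamaguti_hom (k : fieldType) (D D' : lmodType k)
    (l r : D -> D -> D) (l' r' : D' -> D' -> D') (phi : D -> D') :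
  diassociative_hom l r l' r' phi ->
  assoc_yamaguti_hom
    (dias_mul l r) (dias_brk l r) (dias_dbrk l r)
    (dias_mul l' r') (dias_brk l' r') (dias_dbrk l' r') phi.
Proof.
case=> phi_lin phi_l phi_r.
have phiD a b : phi (a + b) = phi a + phi b.
  by have := phi_lin 1 a b; rewrite !scale1r.
have phi0 : phi 0 = 0 by apply: (addrI (phi 0)); rewrite -phiD !addr0.
have phiN a : phi (- a) = - phi a.
  by apply: (addrI (phi a)); rewrite -phiD !subrr.
by split=> // *; rewrite /dias_mul /dias_brk /dias_dbrk ?phiN ?phiD
                       ?(phi_l, phi_r).
Qed.

Theorem theorem3p7 (k : fieldType) (char0 : [pchar k] =i pred0) :
  (forall (D : lmodType k) (l r : D -> D -> D),
     diassociative l r ->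
     [/\ forall a b c : D,
           dias_brk l r a b c = - r (r a b) c /\
           - r (r a b) c = - r a (r b c),
         forall a b c : D,
           dias_dbrk l r a b c = - l a (l b c) /\
           - l a (l b c) = - l (l a b) c
       & assoc_yamaguti (dias_mul l r) (dias_brk l r) (dias_dbrk l r)]) /\
  (forall (D D' : lmodType k) (l r : D -> D -> D) (l' r' : D' -> D' -> D')
          (phi : D -> D'),
     diassociative l r -> diassociative l' r' ->
     diassociative_hom l r l' r' phi ->
     assoc_yamaguti_hom
       (dias_mul l r) (dias_brk l r) (dias_dbrk l r)
       (dias_mul l' r') (dias_brk l' r') (dias_dbrk l' r') phi).
Proof.
split=> [D l r D_dias | D D' l r l' r' phi _ _].
  split; [exact: dias_brkE | exact: dias_dbrkE | exact: dias_assoc_yamaguti].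
exact: dias_hom_assoc_yamaguti_hom.
Qed.
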